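(* Let $s$ and $t$ be integers with $4\le t\le s$. For all sufficiently large $n$, every $3$-uniform hypergraph $\mathcal{H}$ on $n$ vertices not containing $M_{s+1}$ as a trace satisfies \[ k^3_t(\mathcal{H})\le\binom{s+1}{t-1}(n-s-1)+\binom{s+1}{t}. \] The following construction achieves the bound asymptotically. Let $G$ be the complete graph $K_{s+1}$ on $s+1$ vertices; on a set of $n$ vertices containing $V(G)$, for each of the remaining $n-(s+1)$ vertices $v$ and every $e\in E(G)$, let $\{v\}\cup e$ be a hyperedge; then add as hyperedges all $3$-sets contained in $V(G)$. The resulting $3$-uniform hypergraph $\mathcal{H}$ does not contain $M_{s+1}$ as a trace and satisfies $k^3_t(\mathcal{H})=\binom{s+1}{t-1}n+O_{s,t}(1)$.
   Context: $\mathcal{K}^3_t$ is the complete $3$-uniform hypergraph on $t$ vertices, and $k^3_t(\mathcal{H})$ is the number of copies of $\mathcal{K}^3_t$ in $\mathcal{H}$ (i.e. the number of $t$-sets of vertices all of whose $3$-subsets are hyperedges). $M_{s+1}$ is the graph (a matching) consisting of $s+1$ pairwise disjoint edges, on $2(s+1)$ vertices. $O_{s,t}(1)$ denotes a quantity bounded in absolute value by a constant depending only on $s$ and $t$. Trace: for a hypergraph $\mathcal{H}$ and $S\subseteq V(\mathcal{H})$, the trace of $\mathcal{H}$ on $S$ is the hypergraph $\mathcal{H}_{|S}$ on $S$ with hyperedge set $\{e\cap S: e\in E(\mathcal{H})\}$. $\mathcal{H}$ contains a graph $F$ as a trace if there is $S\subseteq V(\mathcal{H})$ with $|S|=v(F)$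 (the number of vertices of $F$) such that $\mathcal{H}_{|S}$ contains $F$ as a sub-hypergraph. *)

(* Defs.v *)
From mathcomp Require Import all_boot all_order all_algebra.

Set Implicit Arguments.
Unset Strict Implicit.
Unset Printing Implicit Defensive.

(* A hypergraph on the vertex set V is given by its set of hyperedges
   E : {set {set V}}; a graph is a 2-uniform one. *)

Definition uniform (V : finType) (r : nat) (E : {set {set V}}) : Prop :=
  forall e : {set V}, e \in E -> #|e| = r.

Definition complete_on (V : finType) (r : nat) (A : {set V}) : {set {set V}} :=
  [set e : {set V} | (e \subset A) && (#|e| == r)].

(* A copy of the complete r-uniform hypergraph on t vertices is determined by
   its vertex set, so copies are counted as t-sets. *)
Definition num_cliques (V : finType) (r t : nat) (E : {set {set V}}) : nat :=
  #|[set T : {set V} | (#|T| == t) && (complete_on r T \subset E)]|.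

Definition trace (V : finType) (E : {set {set V}}) (S : {set V}) :
    {set {set V}} :=
  [set e :&: S | e in E].

(* The hypergraph (S, E) contains a copy of the graph with vertex set W and
   edge set F. *)
Definition contains_copy (V W : finType) (S : {set V}) (E : {set {set V}})
    (F : {set {set W}}) : Prop :=
  exists phi : W -> V,
    [/\ injective phi,
        forall w : W, phi w \in S
      & forall f : {set W}, f \in F -> phi @: f \in E].

Definition contains_as_trace (V W : finType) (E : {set {set V}})
    (F : {set {set W}}) : Prop :=
  exists S : {set V}, #|S| = #|W| /\ contains_copy S (trace E S) F.

Definition matching (k : nat) : {set {set 'I_k * bool}} :=
  [set [set (i, false); (i, true)] | i : 'I_k].

(* A plays the role of V(G), with G the complete graph on A. *)
Definition construction (V : finType) (A : {set V}) : {set {set V}} :=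
  [set v |: e | v in ~: A, e in complete_on 2 A] :|: complete_on 3 A.

(* Main.v *)
Require Import Defs.
From mathcomp Require Import all_boot all_order all_algebra.
From mathcomp Require Import zify.
Import Order.TTheory GRing.Theory Num.Theory.

Set Implicit Arguments.
Unset Strict Implicit.
Unset Printing Implicit Defensive.

(** Why the theorem is true.

    Let E be 3-uniform on n vertices without M_{s+1} as a trace.  A matching
    in the trace on S consists of pairwise disjoint pairs {p, q} together with
    hyperedges {p, q, w} whose third vertex w lies outside S; a list of such
    triples is a [trace_matching], and none has more than s entries.

    Bounded core.  A maximal trace matching meets all hyperedges, and a maximal
    one whose third vertices all equal w meets every hyperedge through w in a
    vertex other than w.  So some set B of size bounded in s contains at least
    two vertices of each hyperedge ([core_exists]), and a t-clique has at most
    one vertex outside B.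

    The graph of popular pairs.  Call a pair popular when more than 3(s+1)
    hyperedges contain it.  If T is a t-clique with a vertex v outside B, then
    either T :&: B is a (t-1)-clique of the popular graph, or v is one of the
    boundedly many third vertices of an unpopular pair of B.  Hence the number
    of t-cliques is at most n times the number of popular (t-1)-cliques, plus a
    constant ([num_cliques_core_bound]).

    Cliques in the popular graph.  If every vertex of a set Y has a popular
    neighbour outside Y, then distinct third vertices can be chosen greedily,
    giving a trace matching with one entry for each of any s+1 vertices of Y;
    so |Y| <= s.  A graph with this property has degree sum at most s(s+2), which is Vizing's bound on the
    number of edges in terms of the domination number ([vizing]).  It has at
    most 'C(s+1, r) cliques of size r for r >= 3, and for r <= s+1 equality
    forces a clique on s+1 vertices ([clique_bound], [clique_bound_tight]).
    The proof counts cliques over edges: if all pairs of adjacent vertices have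
    at most s-2 common neighbours, Vizing's bound gives a strict inequality;
    otherwise there are two adjacent twins of degree s, and deleting one of
    them lowers s by one, so that Pascal's rule closes an induction.

    Conclusion.  If there are fewer than 'C(s+1, t-1) popular (t-1)-cliques,
    the bound holds for n large because the leading coefficient is smaller.
    Otherwise there is a popular clique A on s+1 vertices.  A hyperedge with
    two vertices b, c outside A would give {b, c} and, for s vertices y of A, a
    pair {y, w} coming from a hyperedge {y, x0, w} with x0 in A: a trace
    matching with s+1 entries.  So all hyperedges have two vertices in A, which
    means that E is contained in [construction A]; the latter has exactly
    'C(s+1, t-1)(n-s-1) + 'C(s+1, t) cliques ([num_cliques_construction]). *)

(** * Graphs with bounded escaping sets *)

Section Graphs.
Variable V : finType.
Implicit Types (e : rel V) (U S T Y A : {set V}) (x y z : V) (s r d : nat).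

Definition nbhd e x : {set V} := [set y | e x y].

(** The complement of Y dominates Y.  In a graph without isolated vertices the
    largest escaping sets are the complements of the smallest dominating sets;
    isolated vertices lie in no escaping set, so that bounds on escaping sets
    pass to subgraphs on the same vertex type. *)
Definition escaping e Y : Prop :=
  forall y, y \in Y -> exists2 z, z \notin Y & e y z.

Definition escape_bounded e s : Prop :=
  forall Y, escaping e Y -> #|Y| <= s.

(** The vertex type is kept: the vertices outside U become isolated and so
    belong to no escaping set and to no clique with two or more vertices. *)
Definition induced U e : rel V := [rel x y | [&& e x y, x \in U & y \in U]].

Lemma induced_sym U e : symmetric e -> symmetric (induced U e).
Proof. by move=> es x y; rewrite /induced /= es; congr (_ && _); rewrite andbC. Qed.

Lemma induced_irr U e : irreflexive e -> irreflexive (induced U e).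
Proof. by move=> ei x; rewrite /induced /= ei. Qed.

Lemma degree_bound e s x : symmetric e -> irreflexive e ->
  escape_bounded e s -> #|nbhd e x| <= s.
Proof.
move=> es ei; apply=> y; rewrite inE => exy; exists x; last by rewrite es.
by rewrite inE ei.
Qed.

(** An escaping set found far from x can be enlarged by the whole
    neighbourhood of x, each neighbour escaping to x itself. *)
Lemma escape_outside_nbhd e s x : symmetric e -> irreflexive e ->
  escape_bounded e s ->
  escape_bounded (induced (~: (x |: nbhd e x)) e) (s - #|nbhd e x|).
Proof.
move=> es ei He Y HY; set A := nbhd e x.
have YS y : y \in Y -> y \notin x |: A.
  by move=> /HY[z _ /and3P[_]]; rewrite inE.
have dYA : [disjoint Y & A].
  rewrite disjoint_subset; apply/subsetP => y /YS yS; rewrite [y \in _]inE.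
  by apply: contra yS => yA; rewrite in_setU1 yA orbT.
have : #|Y :|: A| <= s.
  apply: He => y; rewrite inE; case: (boolP (y \in A)) => [yA _|yA].
    exists x; last by move: yA; rewrite es inE.
    rewrite in_setU negb_or; apply/andP; split; last by rewrite inE ei.
    by apply/negP => /YS; rewrite setU11.
  rewrite orbF => /HY[z zY /and3P[eyz _]]; rewrite inE => zS.
  exists z => //; rewrite inE negb_or zY /=.
  by move: zS; rewrite in_setU1 negb_or => /andP[].
by rewrite cardsU disjoint_setI0 // cards0; lia.
Qed.

(** The neighbours of x other than y escape to x, and the neighbours of y
    outside the closed neighbourhood of x escape to y. *)
Lemma outer_degree_bound e s x y : symmetric e -> irreflexive e ->
  escape_bounded e s -> y \in nbhd e x ->
  #|nbhd e y :\: (x |: nbhd e x)| + #|nbhd e x| <= s.+1.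
Proof.
move=> es ei He yA; set A := nbhd e x; set Q := _ :\: _.
have dAQ : [disjoint A :\ y & Q].
  rewrite disjoint_subset; apply/subsetP => v; rewrite in_setD1 => /andP[_ vA].
  by rewrite inE !in_setD in_setU1 vA orbT.
have : #|(A :\ y) :|: Q| <= s.
  apply: He => v; rewrite in_setU => /orP[|].
    rewrite in_setD1 inE => /andP[_ exv]; exists x; last by rewrite es.
    by rewrite !inE ei eqxx !andbF.
  rewrite in_setD => /andP[_]; rewrite inE => eyv.
  exists y; last by rewrite es.
  by rewrite !inE ei eqxx !andbF.
rewrite cardsU disjoint_setI0 // cards0 (cardsD1 y A) yA; lia.
Qed.

(** Both sides count the adjacent pairs in S x A. *)
Lemma sum_swap e (A S : {set V}) : symmetric e ->
  \sum_(z in S) #|nbhd e z :&: A| = \sum_(y in A) #|nbhd e y :&: S|.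
Proof.
move=> es.
have E B z : #|nbhd e z :&: B| = \sum_(y in B) e z y.
  rewrite -sum1_card [RHS]big_mkcond [LHS]big_mkcond /=; apply: eq_bigr => y _.
  by rewrite !inE; case: (e z y); case: (y \in B).
under eq_bigr do rewrite E; under [RHS]eq_bigr do rewrite E.
by rewrite exchange_big /=; apply: eq_bigr => y _; apply: eq_bigr => z _; rewrite es.
Qed.

(** Vizing's theorem on edges and domination.  With x of maximum degree d, A
    its neighbourhood and S the rest: the vertices of A contribute at most d
    each, the edges between A and S number at most d(s+1-d), and the graph on S
    is handled by induction with s-d in place of s. *)
Lemma vizing e s : symmetric e -> irreflexive e -> escape_bounded e s ->
  \sum_x #|nbhd e x| <= s * (s + 2).
Proof.
elim/ltn_ind: s e => s IH e es ei He.
case: (pickP V) => [x0 _|V0]; last by rewrite big_pred0.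
case: (@arg_maxnP V x0 predT (fun x => #|nbhd e x|) isT) => x _ xmax.
set A := nbhd e x; set d := #|A|; set S := ~: (x |: A).
have dmax y : #|nbhd e y| <= d by apply: xmax.
have ds : d <= s by apply: degree_bound.
case: (posnP d) => [d0|d_gt0].
  by rewrite big1 // => y _; apply/eqP; rewrite -leqn0 -d0.
have inS : \sum_(z in S) #|nbhd e z :&: S| <= (s - d) * (s - d + 2).
  have sub : \sum_(z in S) #|nbhd e z :&: S| <= \sum_z #|nbhd (induced S e) z|.
    rewrite [leqRHS](bigID (mem S)) /=; apply: leq_trans (leq_addr _ _).
    apply: leq_sum => z zS; apply: subset_leq_card; apply/subsetP => v.
    rewrite in_setI [v \in nbhd e z]inE [in X in _ -> X]inE /induced /= zS.
    by move=> /andP[-> ->].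
  apply: (leq_trans sub); apply: IH; first by lia.
  - exact: induced_sym.
  - exact: induced_irr.
  - exact: escape_outside_nbhd.
have AS : \sum_(z in S) #|nbhd e z :&: A| <= d * (s.+1 - d).
  rewrite sum_swap // -sum_nat_const; apply: leq_sum => y yA.
  by have := outer_degree_bound es ei He yA; rewrite -setDE -/A -/d; lia.
have degS z : z \in S -> #|nbhd e z| = #|nbhd e z :&: S| + #|nbhd e z :&: A|.
  rewrite inE => zS; rewrite -(cardsID S) setDE setCK; congr (_ + _).
  apply: eq_card => v; rewrite !inE; case: (v =P x) => //= ->.
  rewrite ei andbF andbT; apply/negP => ezx; case/negP: zS.
  by rewrite !inE es ezx orbT.
rewrite (bigID (mem S)) /= (eq_bigr _ degS) big_split /=.
have -> : \sum_(i | i \notin S) #|nbhd e i| = d + \sum_(y in A) #|nbhd e y|.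
  rewrite -big_setU1 /=; last by rewrite inE ei.
  by apply: eq_bigl => v; rewrite inE negbK.
have degA : \sum_(y in A) #|nbhd e y| <= d * d.
  by rewrite -sum_nat_const; apply: leq_sum.
move: inS AS degA.
move: (\sum_(y in A) _) (\sum_(z in S) _) (\sum_(z in S) _) => a b c; nia.
Qed.

Definition is_clique e T : bool :=
  [forall x in T, forall y in T, (x != y) ==> e x y].

Definition cliques e r : {set {set V}} :=
  [set T : {set V} | (#|T| == r) && is_clique e T].

Lemma is_cliqueP e T :
  reflect {in T &, forall x y, x != y -> e x y} (is_clique e T).
Proof.
apply: (iffP forall_inP) => [H x y xT yT xy|H x xT].
  by have /forall_inP/(_ y yT)/implyP := H x xT; apply.
by apply/forall_inP => y yT; apply/implyP; apply: H.
Qed.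

(** A clique without one of its vertices is escaping. *)
Lemma clique_size_bound e s T :
  escape_bounded e s -> is_clique e T -> #|T| <= s.+1.
Proof.
move=> He /is_cliqueP cT; have [->|[v vT]] := set_0Vmem T; first by rewrite cards0.
rewrite (cardsD1 v) vT add1n ltnS; apply: He => y; rewrite in_setD1 => /andP[yv yT].
by exists v; [rewrite setD11 | apply: cT].
Qed.

Lemma card_cliques_through_edge e r x y : e x y -> irreflexive e ->
  #|[set T in cliques e r.+2 | (x \in T) && (y \in T)]|
    <= 'C(#|nbhd e x :&: nbhd e y|, r).
Proof.
move=> exy ei; rewrite -cards_draws; set X := [set T in _ | _].
have yx : y != x by apply/eqP => yx; rewrite yx ei in exy.
have XP T : T \in X -> [/\ #|T| = r.+2, is_clique e T, x \in T & y \in T].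
  by rewrite inE inE => /andP[/andP[/eqP ? ?] /andP[? ?]].
rewrite -(card_in_imset (D := X) (f := fun T => T :\ x :\ y)) => [|T1 T2]; last first.
  move=> /XP[_ _ x1 y1] /XP[_ _ x2 y2] /(congr1 (fun T => x |: (y |: T))).
  by rewrite !setD1K // in_setD1 ?yx.
apply/subset_leq_card/subsetP => _ /imsetP[T /XP[cT /is_cliqueP qT xT yT] ->].
rewrite inE; apply/andP; split.
  apply/subsetP => z; rewrite in_setD1 in_setD1 => /and3P[zy zx zT].
  by rewrite in_setI !inE !qT // eq_sym.
move: cT; rewrite (cardsD1 x) xT (cardsD1 y) in_setD1 yx yT; lia.
Qed.

(** Double counting of the cliques with an ordered pair of their vertices. *)
Lemma clique_edge_count e r : symmetric e -> irreflexive e ->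
  r.+2 * r.+1 * #|cliques e r.+2|
    <= \sum_x \sum_(y in nbhd e x) 'C(#|nbhd e x :&: nbhd e y|, r).
Proof.
move=> es ei.
have cT T : T \in cliques e r.+2 ->
    r.+2 * r.+1 = \sum_x \sum_(y in nbhd e x) ((x \in T) && (y \in T)).
  rewrite inE => /andP[/eqP cT /is_cliqueP qT].
  rewrite (bigID (mem T)) /= [X in _ + X]big1 => [|x /negbTE xT]; last first.
    by rewrite big1 // => y _; rewrite xT.
  rewrite addn0 -{1}cT -sum_nat_const; apply: eq_bigr => x xT.
  have -> : r.+1 = #|T :\ x| by move: cT; rewrite (cardsD1 x) xT => -[].
  rewrite -sum1_card big_mkcond [RHS]big_mkcond /=; apply: eq_bigr => y _.
  rewrite in_setD1 xT [y \in nbhd e x]inE; case: (y =P x) => [->|/eqP yx] /=.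
    by rewrite ei.
  by case: (boolP (y \in T)) => [yT|]; rewrite ?if_same // qT // eq_sym.
rewrite mulnC -sum_nat_const (eq_bigr _ cT) exchange_big /=.
apply: leq_sum => x _; rewrite exchange_big /=; apply: leq_sum => y.
rewrite inE => exy; apply: leq_trans (card_cliques_through_edge r exy ei).
rewrite -sum1_card [leqRHS]big_mkcond [leqLHS]big_mkcond /=.
apply: leq_sum => T _; rewrite [in leqRHS]inE.
by case: (T \in cliques e r.+2) => //=; case: (_ && _).
Qed.

(** With codegrees at most s-2, counting over edges gives
    r(r-1) #|cliques| <= s(s+2) 'C(s-2, r-2), and this is smaller than
    r(r-1) 'C(s+1, r) = (s+1)s 'C(s-1, r-2) because r >= 3.  For edges (r = 2)
    and s even, the complete graph on s+2 vertices minus a perfect matching is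
    a counterexample. *)
Lemma few_cliques_small_codegree e s r : symmetric e -> irreflexive e ->
  escape_bounded e s -> 2 < r <= s.+1 ->
  (forall x y, e x y -> #|nbhd e x :&: nbhd e y| + 1 < s) ->
  #|cliques e r| < 'C(s.+1, r).
Proof.
move=> es ei He; case: r => [|[|k]] //= /andP[k_gt0 ks] codeg.
have k1 : 0 < k by lia.
have cnt : k.+2 * k.+1 * #|cliques e k.+2| <= s * (s + 2) * 'C(s.-2, k).
  apply: leq_trans (clique_edge_count k es ei) _.
  apply: leq_trans (leq_mul (vizing es ei He) (leqnn _)).
  rewrite big_distrl /=; apply: leq_sum => x _; rewrite -sum_nat_const.
  apply: leq_sum => y; rewrite inE => /codeg exy; apply: leq_bin2l; lia.
have b1 : s.+1 * 'C(s, k.+1) = k.+2 * 'C(s.+1, k.+2) by rewrite -mul_bin_diag.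
have b2 : s * 'C(s.-1, k) = k.+1 * 'C(s, k.+1) by rewrite mul_bin_diag.
have b3 : s.-1 * 'C(s.-2, k) = (s.-1 - k) * 'C(s.-1, k) by rewrite mul_bin_down.
have b4 : 0 < 'C(s.-1, k) by rewrite bin_gt0; lia.
have b5 : s * (s + 2) * 'C(s.-2, k) < s.+1 * s * 'C(s.-1, k).
  have -> : s * (s + 2) * 'C(s.-2, k) = s * ((s + 2) * 'C(s.-2, k)) by lia.
  have -> : s.+1 * s * 'C(s.-1, k) = s * (s.+1 * 'C(s.-1, k)) by lia.
  rewrite ltn_pmul2l; last by lia.
  rewrite -(@ltn_pmul2l s.-1); last by lia.
  rewrite mulnCA b3 !mulnA ltn_pmul2r //.
  nia.
have : k.+2 * k.+1 * #|cliques e k.+2| < k.+2 * k.+1 * 'C(s.+1, k.+2).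
  apply: leq_ltn_trans cnt (leq_trans b5 _); nia.
by rewrite ltn_pmul2l.
Qed.

(** A clique through x is determined by its other vertices, which are
    neighbours of x; if the number of these cliques is the largest possible,
    then every subset of the right size occurs. *)
Lemma card_cliques_at e r x :
  #|[set T in cliques e r.+1 | x \in T]| <= 'C(#|nbhd e x|, r)
  /\ (#|[set T in cliques e r.+1 | x \in T]| = 'C(#|nbhd e x|, r) ->
      forall A, A \subset nbhd e x -> #|A| = r -> is_clique e (x |: A)).
Proof.
set X := [set T in _ | _].
have XP T : T \in X -> [/\ #|T| = r.+1, is_clique e T & x \in T].
  by rewrite inE inE => /andP[/andP[/eqP ? ?] ?].
have cX : #|[set T :\ x | T in X]| = #|X|.
  apply: card_in_imset => T1 T2.
  move=> /XP[_ _ x1] /XP[_ _ x2] /(congr1 (fun T => x |: T)).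
  by rewrite !setD1K.
have sub : [set T :\ x | T in X] \subset
    [set A : {set V} | A \subset nbhd e x & #|A| == r].
  apply/subsetP => _ /imsetP[T /XP[cT /is_cliqueP qT xT] ->].
  rewrite inE; apply/andP; split; last by move: cT; rewrite (cardsD1 x) xT; lia.
  apply/subsetP => z; rewrite in_setD1 => /andP[zx zT].
  by rewrite inE qT // eq_sym.
split; first by rewrite -cX -cards_draws; apply: subset_leq_card.
move=> eqX A sA cA.
have /eqP eqS : [set T :\ x | T in X] ==
    [set A : {set V} | A \subset nbhd e x & #|A| == r].
  by rewrite eqEcard sub cX eqX cards_draws leqnn.
have : A \in [set A : {set V} | A \subset nbhd e x & #|A| == r].
  by rewrite inE sA cA eqxx.
by rewrite -eqS => /imsetP[T /XP[_ qT xT] ->]; rewrite setD1K.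
Qed.

Lemma card_cliques_delete e r x :
  #|cliques e r| <= #|cliques (induced (~: [set x]) e) r|
                     + #|[set T in cliques e r | x \in T]|.
Proof.
rewrite -(cardsID [set T : {set V} | x \in T]) addnC; apply: leq_add.
  apply/subset_leq_card/subsetP => T.
  rewrite in_setD !inE => /andP[xT /andP[-> /is_cliqueP qT]] /=.
  apply/is_cliqueP => u v uT vT uv; rewrite /induced /= !inE qT //=.
  by apply/andP; split; apply: contraNneq xT => <-.
by apply/subset_leq_card/subsetP => T; rewrite in_setI !inE.
Qed.

(** Since degrees are at most s, a codegree of s-1 forces x and y to have the
    same closed neighbourhood, of size s+1.  If deleting x left an escaping set
    Y of size s, then x could be added to Y unless all neighbours of x are in
    Y; but then Y is the neighbourhood of x, and y has nowhere to escape. *)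
Lemma full_codegree_twins e s x y : symmetric e -> irreflexive e ->
  escape_bounded e s -> e x y -> s <= #|nbhd e x :&: nbhd e y| + 1 ->
  #|nbhd e x| = s /\ escape_bounded (induced (~: [set x]) e) s.-1.
Proof.
move=> es ei He exy codeg; set C := _ :&: _ in codeg.
have xC : x \notin C by rewrite !inE ei.
have yC : y \notin C by rewrite !inE ei andbF.
have Nx : nbhd e x = y |: C.
  apply/eqP; rewrite eq_sym eqEcard subUset sub1set inE exy subsetIl /=.
  by rewrite cardsU1 yC add1n -addn1 (leq_trans _ codeg) // degree_bound.
have Ny : nbhd e y = x |: C.
  apply/eqP; rewrite eq_sym eqEcard subUset sub1set inE es exy subsetIr /=.
  by rewrite cardsU1 xC add1n -addn1 (leq_trans _ codeg) // degree_bound.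
have dx : #|nbhd e x| = s.
  apply/eqP; rewrite eqn_leq degree_bound //= Nx cardsU1 yC; lia.
split=> // Y HY; rewrite leqNgt; apply/negP => Ys.
have xY : x \notin Y.
  by apply/negP => /HY[z _ /and3P[_]]; rewrite !inE eqxx.
have HY' u : u \in Y -> exists2 z, z \notin x |: Y & e u z.
  move=> /HY[z zY /and3P[euz _]]; rewrite !inE => zx.
  by exists z => //; rewrite !inE negb_or zx.
have Y_le : #|Y| <= s.
  by apply: He => u /HY'[z]; rewrite !inE negb_or => /andP[_ zY] euz; exists z.
have sNY : nbhd e x \subset Y.
  apply/subsetP => z zN; apply: contraT => zY.
  have : #|x |: Y| <= s.
    apply: He => u; rewrite in_setU1 => /predU1P[->|/HY'//].
    exists z; last by move: zN; rewrite inE.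
    rewrite in_setU1 negb_or zY andbT; apply: contraTneq zN => ->.
    by rewrite inE ei.
  by rewrite cardsU1 xY; lia.
have eNY : nbhd e x = Y by apply/eqP; rewrite eqEcard sNY dx.
have yY : y \in Y by rewrite -eNY inE.
have [z zY eyz] := HY' y yY; case/negP: zY.
have : z \in nbhd e y by rewrite inE.
rewrite Ny !in_setU1 => /orP[->//|zC].
by rewrite -eNY Nx in_setU1 zC !orbT.
Qed.

(** The dichotomy on which both the clique bound and its equality case rest:
    either a vertex can be deleted at the price of lowering s, or the bound is
    strict. *)
Lemma twins_or_few_cliques e s r : symmetric e -> irreflexive e ->
  escape_bounded e s -> 2 < r <= s.+1 ->
  (exists x, #|nbhd e x| = s /\ escape_bounded (induced (~: [set x]) e) s.-1)
  \/ #|cliques e r| < 'C(s.+1, r).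
Proof.
move=> es ei He rs.
have [/existsP[x /existsP[y /andP[exy cxy]]]|sparse] :=
  boolP [exists x, exists y, e x y && (s <= #|nbhd e x :&: nbhd e y| + 1)].
  by left; exists x; apply: full_codegree_twins exy cxy.
right; apply: few_cliques_small_codegree => // x y exy.
rewrite ltnNge; apply: contra sparse => cxy.
by apply/existsP; exists x; apply/existsP; exists y; rewrite exy.
Qed.

Lemma no_large_cliques e s r :
  escape_bounded e s -> s.+1 < r -> #|cliques e r| = 0.
Proof.
move=> He sr; apply/eqP; rewrite cards_eq0; apply/eqP/setP => T.
rewrite !inE; apply/negP => /andP[/eqP cT /(clique_size_bound He)]; lia.
Qed.

Lemma clique_bound e s r : symmetric e -> irreflexive e ->
  escape_bounded e s -> 2 < r -> #|cliques e r| <= 'C(s.+1, r).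
Proof.
elim: s e => [|s IH] e es ei He r3; first by rewrite (no_large_cliques He) // ltnW.
have [rs|rs] := ltnP s.+2 r; first by rewrite (no_large_cliques He).
have [|[x [dx Hx]]|/ltnW//] := @twins_or_few_cliques e s.+1 r es ei He.
  by rewrite r3.
case: r r3 IH {rs} => // r r3 IH; apply: leq_trans (card_cliques_delete e _ x) _.
rewrite binS; apply: leq_add.
  exact: (IH _ (induced_sym _ es) (induced_irr _ ei) Hx r3).
by rewrite -dx; case: (card_cliques_at e r x).
Qed.

(** In the twin case equality in Pascal's rule makes every (r-1)-subset of the
    neighbourhood of x part of a clique through x.  As r-1 >= 2, any two
    neighbours of x lie in such a subset, so that they are adjacent. *)
Lemma clique_bound_tight e s r : symmetric e -> irreflexive e ->
  escape_bounded e s -> 2 < r <= s.+1 -> 'C(s.+1, r) <= #|cliques e r| ->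
  exists A : {set V}, #|A| = s.+1 /\ is_clique e A.
Proof.
move=> es ei He rs; have [[x [dx Hx]] big|lt] := twins_or_few_cliques es ei He rs;
  last by rewrite leqNgt lt.
case: r rs big => // r /andP[r3 rs] big.
have s_gt0 : 0 < s by lia.
have bdel : #|cliques (induced (~: [set x]) e) r.+1| <= 'C(s, r.+1).
  by have := clique_bound (induced_sym _ es) (induced_irr _ ei) Hx r3; rewrite prednK.
have [le_at eq_at] := card_cliques_at e r x.
have del := card_cliques_delete e r.+1 x.
rewrite dx in le_at eq_at; rewrite binS in big.
have /eq_at all_cliques : #|[set T in cliques e r.+1 | x \in T]| = 'C(s, r) by lia.
exists (x |: nbhd e x); split; first by rewrite cardsU1 inE ei dx.
apply/is_cliqueP => u v; rewrite !in_setU1.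
case/predU1P => [->|uN]; case/predU1P => [->|vN]; rewrite ?eqxx //.
- by move: vN; rewrite inE.
- by move: uN; rewrite inE es.
(* A clique through x, u and v is sought: complete {u, v} by r-2 neighbours. *)
move=> uv; pose W := nbhd e x :\: [set u; v].
have cW : #|W| = s - 2.
  have := cardsID [set u; v] (nbhd e x).
  rewrite -/W dx; suff -> : nbhd e x :&: [set u; v] = [set u; v].
    by rewrite cards2 uv; lia.
  by apply/setIidPr; rewrite subUset !sub1set uN vN.
have /card_gt0P[B] : 0 < #|[set B : {set V} | B \subset W & #|B| == r - 2]|.
  by rewrite cards_draws cW bin_gt0; lia.
rewrite inE => /andP[sB /eqP cB].
have uB : u \notin B.
  by apply/negP => /(subsetP sB); rewrite in_setD in_set2 eqxx.
have vB : v \notin B.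
  by apply/negP => /(subsetP sB); rewrite in_setD in_set2 eqxx orbT.
have /all_cliques/(_ _)/is_cliqueP q : u |: (v |: B) \subset nbhd e x.
  rewrite !subUset !sub1set uN vN; apply: subset_trans sB _.
  exact: subsetDl.
by apply: q => //; rewrite ?cardsU1 ?in_setU1 ?negb_or ?uv ?uB ?vB ?eqxx ?orbT //; lia.
Qed.

End Graphs.

Lemma notin_cat (T : eqType) (x : T) s1 s2 :
  (x \notin s1 ++ s2) = (x \notin s1) && (x \notin s2).
Proof. by rewrite mem_cat negb_or. Qed.

(** * Trace matchings *)

Lemma maximal_seq (T : finType) (P : pred (seq T)) s : P [::] ->
  (forall l, P l -> size l <= s) -> exists2 l, P l & forall x, ~~ P (x :: l).
Proof.
move=> P0 Ps.
suff H k l : P l -> s < size l + k -> exists2 l, P l & forall x, ~~ P (x :: l).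
  by apply: (H s.+1 [::]).
elim: k l => [|k IH] l Pl; first by rewrite addn0 ltnNge Ps.
have [/existsP[x Px] sl|/existsPn nP] := boolP [exists x, P (x :: l)].
  by apply: IH Px _; rewrite /=; lia.
by exists l.
Qed.

Section TraceMatchings.
Variables (V : finType) (E : {set {set V}}).
Hypothesis E3 : uniform 3 E.
Implicit Types (l : seq (V * V * V)) (x : V * V * V) (e A B S T Y : {set V}).

Definition ends l : seq V := [seq x.1.1 | x <- l] ++ [seq x.1.2 | x <- l].

Definition apexes l : seq V := [seq x.2 | x <- l].

(** An entry (p, q, w) stands for the hyperedge {p, q, w} whose trace on the
    set of all ends is the matching edge {p, q}. *)
Definition trace_matching l : bool :=
  [&& uniq (ends l), all (fun x => [set x.1.1; x.1.2; x.2] \in E) l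
    & all (fun x => x.2 \notin ends l) l].

Lemma size_ends l : size (ends l) = size l + size l.
Proof. by rewrite size_cat !size_map. Qed.

Lemma mem_ends_cons u x l :
  (u \in ends (x :: l)) = [|| u == x.1.1, u == x.1.2 | u \in ends l].
Proof.
rewrite /= mem_cat !inE mem_cat.
by case: (_ == _); case: (_ == _); rewrite ?orbT.
Qed.

Lemma uniq_ends_cons x l : uniq (ends (x :: l)) =
  [&& x.1.1 != x.1.2, x.1.1 \notin ends l, x.1.2 \notin ends l & uniq (ends l)].
Proof.
rewrite (perm_uniq (s2 := x.1.1 :: x.1.2 :: ends l)) /=; last first.
  by rewrite perm_cons perm_sym -cat1s perm_catCA.
by rewrite in_cons negb_or -!andbA; do !bool_congr.
Qed.

Lemma edge_distinct p q w : [set p; q; w] \in E -> [/\ p != q, w != p & w != q].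
Proof.
move=> /E3; rewrite setUC cardsU1 cards2 in_set2 negb_or.
by case: (p == q); case: (w == p); case: (w == q).
Qed.

Lemma trace_matching_cons p q w l : trace_matching l ->
  [set p; q; w] \in E -> p \notin ends l ++ apexes l ->
  q \notin ends l ++ apexes l -> w \notin ends l ->
  trace_matching ((p, q, w) :: l).
Proof.
case/and3P => ul Hl al epqw; have [pq wp wq] := edge_distinct epqw.
rewrite (notin_cat p) (notin_cat q) => /andP[pe pa] /andP[qe qa] we.
apply/and3P; split; first by rewrite uniq_ends_cons pq pe qe ul.
  by rewrite /= epqw.
apply/allP => x; rewrite mem_ends_cons !negb_or /= in_cons.
case/predU1P => [-> /=|xl]; first by rewrite wp wq we.
rewrite (allP al) // andbT; have xa : x.2 \in apexes l by apply: map_f.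
by apply/andP; split; [apply: contraNneq pa | apply: contraNneq qa] => <-.
Qed.

Lemma trace_matching_contains l k :
  trace_matching l -> k <= size l -> contains_as_trace E (matching k).
Proof.
case/and3P => ul /allP Hl /allP al kl.
pose t (i : 'I_k) := tnth (in_tuple l) (widen_ord kl i).
have tl i : t i \in l by apply: mem_tnth.
pose phi (ib : 'I_k * bool) := if ib.2 then (t ib.1).1.2 else (t ib.1).1.1.
have phiE d (i : 'I_k) b : phi (i, b) = nth d (ends l) (if b then size l + i else i).
  have il : i < size l by apply: leq_trans (ltn_ord _) kl.
  rewrite /phi /t (tnth_nth (d, d, d)) /= nth_cat size_map.
  case: b; first by rewrite ltnNge leq_addr /= addKn (nth_map (d, d, d)).
  by rewrite il (nth_map (d, d, d)).
have phi_ends ib : phi ib \in ends l.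
  rewrite mem_cat /phi; apply/orP; case: ifP => _; [right | left].
    by apply: (map_f (fun x => x.1.2)).
  by apply: (map_f (fun x => x.1.1)).
have phi_inj : injective phi.
  move=> [i b] [j c]; have d : V := (t i).1.1.
  have il : i < size l by apply: leq_trans (ltn_ord _) kl.
  have jl : j < size l by apply: leq_trans (ltn_ord _) kl.
  rewrite !(phiE d) => /eqP; rewrite nth_uniq // ?size_ends.
  - by case: b; case: c => /eqP eqij; try lia; congr (_, _); apply: val_inj => /=; lia.
  - by case: (b); lia.
  - by case: (c); lia.
exists (phi @: setT); split; first by rewrite card_imset // cardsT.
exists phi; split=> // [ib|f /imsetP[i _ ->]]; first by rewrite imset_f.
apply/imsetP; exists [set (t i).1.1; (t i).1.2; (t i).2]; first exact: Hl.
rewrite imsetU !imset_set1; apply/setP => v; rewrite in_setI !in_setU !in_set1.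
apply/idP/idP.
  move=> vi; rewrite {1}/phi /= in vi; rewrite vi /=.
  by case/orP: vi => /eqP->; apply/imsetP; [exists (i, false) | exists (i, true)].
case/andP => /orP[//|/eqP->] /imsetP[ib _ eqv].
by have := al _ (tl i); rewrite eqv phi_ends.
Qed.

Definition codegree u v := #|[set w | [set u; v; w] \in E]|.

Definition popular K : rel V := [rel u v | (u != v) && (K < codegree u v)].

Lemma popular_sym K : symmetric (popular K).
Proof.
move=> u v; rewrite /popular /= eq_sym /codegree.
by under eq_finset => w do rewrite [[set u; v]]setUC.
Qed.

Lemma popular_irr K : irreflexive (popular K).
Proof. by move=> u; rewrite /popular /= eqxx. Qed.

(** A popular pair has more third vertices than any short list can block. *)
Lemma popular_avoid K u v (bad : seq V) : popular K u v -> size bad <= K ->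
  exists2 w, w \notin bad & [set u; v; w] \in E.
Proof.
case/andP => _ cd sK.
have /subsetPn[w] : ~~ ([set w | [set u; v; w] \in E] \subset [set w in bad]).
  apply: contraL cd => /subset_leq_card le; rewrite -leqNgt /codegree.
  by apply: leq_trans le (leq_trans _ sK); rewrite cardsE card_size.
by rewrite !inE => ? ?; exists w.
Qed.

(** Greedy choice: y is matched with a fresh vertex w of a hyperedge
    {y, g y, w}, the vertex g y staying outside the ends.  The bound on K
    covers the vertices in use (three per entry) and those reserved for later
    (two per remaining y). *)
Lemma popular_extend K l (Y : seq V) (g : V -> V) : trace_matching l ->
  uniq Y -> 3 * (size l + size Y) <= K ->
  (forall y, y \in Y -> [/\ y \notin ends l ++ apexes l, g y \notin ends l,
                            g y \notin Y & popular K y (g y)]) ->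
  exists2 l', trace_matching l' & size l' = size l + size Y.
Proof.
elim: Y l => [|y Y IH] l Hl; first by exists l => //; rewrite addn0.
move=> /= /andP[yY uY] sK HY.
have [yl gl gY yg] := HY y (mem_head _ _).
have [|w wbad ew] :=
  @popular_avoid K y (g y) (ends l ++ apexes l ++ Y ++ map g Y) yg.
  by rewrite !size_cat !size_map; lia.
move: wbad; rewrite (notin_cat w (ends l)) (notin_cat w (apexes l)) (notin_cat w Y).
case/and4P => we wa wY wgY.
have [|||l' Hl' sl'] := IH ((y, w, g y) :: l) _ uY.
- apply: trace_matching_cons => //; first by rewrite setUAC.
  by rewrite notin_cat we.
- by rewrite /= addSnnS.
- move=> z zY; have [zl gzl gzY zg] := HY z (mem_behead (s := y :: Y) zY).
  move: zl; rewrite notin_cat => /andP[zl za].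
  move: gzY; rewrite in_cons negb_or => /andP[gzy gzY].
  split=> //.
    rewrite notin_cat mem_ends_cons /= in_cons !negb_or zl za !andbT -!andbA.
    apply/and3P; split; first by apply: contraNneq yY => <-.
      by apply: contraNneq wY => <-.
    by apply: contraNneq gY => <-; rewrite in_cons zY orbT.
  rewrite mem_ends_cons !negb_or gzy gzl andbT /=.
  by apply: contraNneq wgY => <-; apply: map_f.
by exists l' => //; rewrite sl' /= addSnnS.
Qed.

Lemma popular_escape_bounded s : ~ contains_as_trace E (matching s.+1) ->
  escape_bounded (popular (3 * s.+1)) s.
Proof.
move=> noM Y HY; rewrite leqNgt; apply/negP => Ys; apply: noM.
set K := 3 * _ in HY.
(* The default y is never returned: every y in Y has such a z. *)
pose g y := odflt y [pick z | (z \notin Y) && popular K y z].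
have gP y : y \in Y -> g y \notin Y /\ popular K y (g y).
  move=> /HY[z zY yz]; rewrite /g; case: pickP => [u /andP[]//|/(_ z)].
  by rewrite zY yz.
have sY : size (take s.+1 (enum Y)) = s.+1.
  by rewrite size_takel // -cardE.
have tY y : y \in take s.+1 (enum Y) -> y \in Y.
  by move/mem_take; rewrite mem_enum.
have [||||l Hl sl] := @popular_extend K [::] (take s.+1 (enum Y)) g.
- by [].
- exact/take_uniq/enum_uniq.
- by rewrite sY.
- move=> y /tY /gP[gY yg]; split=> //.
  by apply: contra gY => /tY.
by apply: trace_matching_contains Hl _; rewrite sl sY.
Qed.

Lemma edge_split e b c : e \in E -> b \in e -> c \in e -> b != c ->
  exists a, e = [set b; c; a].
Proof.
move=> /E3 e3 be ce bc.
have /cards1P[a ea] : #|e :\ b :\ c| == 1.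
  move: e3; rewrite (cardsD1 b) be (cardsD1 c) in_setD1 eq_sym bc ce; lia.
exists a; rewrite -setUA -ea.
have /setD1K-> : c \in e :\ b by rewrite in_setD1 eq_sym bc.
by rewrite setD1K.
Qed.

(** From a hyperedge {b, c, a} with b, c outside A, a trace matching with s+1
    entries arises by adding the star in A centred at x0; the centre is a when
    a is in A, so that a is not used as an end. *)
Lemma edges_meet_popular_clique s A e :
  ~ contains_as_trace E (matching s.+1) -> #|A| = s.+1 ->
  is_clique (popular (3 * s.+1)) A -> e \in E -> 1 < #|e :&: A|.
Proof.
move=> noM cA /is_cliqueP qA eE; rewrite ltnNge; apply/negP => eA; apply: noM.
have : 1 < #|e :\: A| by have := cardsID A e; rewrite (E3 eE); lia.
case/card_gt1P => b [c [/setDP[be bA] /setDP[ce cA'] bc]].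
have [a ea] := edge_split eE be ce bc.
have [x0 x0A ax0] : exists2 x0, x0 \in A & a \notin A :\ x0.
  have [aA|aA] := boolP (a \in A); first by exists a; rewrite ?setD11.
  have /card_gt0P[x0 x0A] : 0 < #|A| by rewrite cA.
  by exists x0 => //; rewrite in_setD1 (negbTE aA) andbF.
have l0 : trace_matching [:: (b, c, a)].
  by apply: trace_matching_cons => //; rewrite -ea.
have sA : size (enum (A :\ x0)) = s.
  by rewrite -cardE; move: cA; rewrite (cardsD1 x0) x0A => -[].
have [||l Hl sl] := popular_extend (K := 3 * s.+1) (g := fun=> x0) l0
                      (enum_uniq (A :\ x0)).
- by rewrite sA.
- move=> y; rewrite mem_enum => yA; move: (yA); rewrite in_setD1 => /andP[yx yA'].
  split; last by apply: qA.
  + rewrite /= !inE !negb_or /=.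
    by apply/and3P; split; [apply: contraNneq bA | apply: contraNneq cA'
                           | apply: contraNneq ax0] => <-.
  + by rewrite /= !inE !negb_or /=; apply/andP; split;
      [apply: contraNneq bA | apply: contraNneq cA'] => <-.
  + by rewrite mem_enum setD11.
by apply: trace_matching_contains Hl _; rewrite sl sA.
Qed.

(** A hyperedge disjoint from a maximal trace matching would extend it. *)
Lemma edge_cover s : ~ contains_as_trace E (matching s.+1) ->
  exists2 B : {set V}, #|B| <= 3 * s
    & forall e, e \in E -> exists2 w, w \in e & w \in B.
Proof.
move=> noM.
have [|l Hl lmax] := @maximal_seq _ trace_matching s isT.
  move=> l Hl; rewrite leqNgt; apply/negP => sl.
  by apply: noM; apply: trace_matching_contains Hl sl.
have sl : size l <= s.
  by rewrite leqNgt; apply/negP => sl; apply: noM; apply: trace_matching_contains Hl sl.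
exists [set v in ends l ++ apexes l].
  rewrite cardsE (leq_trans (card_size _)) //.
  by rewrite size_cat size_ends size_map !mulSn addn0 addnA !leq_add.
move=> e eE; have [/existsP[w /andP[we wB]]|/existsPn dis] :=
  boolP [exists w, (w \in e) && (w \in ends l ++ apexes l)].
  by exists w; rewrite // inE.
have : 1 < #|e| by rewrite E3.
case/card_gt1P => b [c [be ce bc]]; have [a ea] := edge_split eE be ce bc.
have out v : v \in e -> v \notin ends l ++ apexes l.
  by move=> ve; have := dis v; rewrite ve.
case/negP: (lmax (b, c, a)); apply: trace_matching_cons; rewrite -?ea ?out //.
have : a \in e by rewrite ea !inE eqxx orbT.
by move/out; rewrite notin_cat => /andP[].
Qed.

(** The same argument in the link of w: all entries have w as third vertex. *)
Lemma link_cover s w : ~ contains_as_trace E (matching s.+1) ->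
  exists C : {set V}, #|C| <= 2 * s /\
    forall e, e \in E -> w \in e -> exists2 v, v \in e :\ w & v \in C.
Proof.
move=> noM.
pose P l := trace_matching l && all (pred1 w) (apexes l).
have size_le l : P l -> size l <= s.
  case/andP => Hl _; rewrite leqNgt; apply/negP => sl.
  by apply: noM; apply: trace_matching_contains Hl sl.
have [l /andP[Hl al] lmax] := @maximal_seq _ P s isT size_le.
have sl : size l <= s by apply: size_le; apply/andP.
exists [set v in ends l]; split.
  rewrite cardsE (leq_trans (card_size _)) //.
  by rewrite size_ends mul2n -addnn leq_add.
move=> e eE we.
have [/existsP[v /andP[ve vC]]|/existsPn dis] :=
  boolP [exists v, (v \in e :\ w) && (v \in ends l)].
  by exists v; rewrite // inE.
have : 1 < #|e :\ w| by have := E3 eE; rewrite (cardsD1 w) we; lia.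
case/card_gt1P => b [c [be ce bc]].
have out v : v \in e :\ w -> v \notin ends l ++ apexes l.
  move=> ve; rewrite notin_cat; apply/andP; split.
    by have := dis v; rewrite ve.
  by apply/negP => /(allP al) /= /eqP vw; move: ve; rewrite vw setD11.
move: (be) (ce); rewrite !in_setD1 => /andP[bw be'] /andP[cw ce'].
have [a ea] := edge_split eE be' ce' bc.
have {}ea : e = [set b; c; w].
  move: we; rewrite {1}ea !inE eq_sym (negbTE bw) eq_sym (negbTE cw) /=.
  by move/eqP->.
case/negP: (lmax (b, c, w)); apply/andP; split; last by rewrite /= eqxx.
apply: trace_matching_cons; rewrite -?ea ?out //.
case: (l) Hl al => [//|x l'] /and3P[_ _ /= /andP[xl _]] /= /andP[/eqP xw _].
by rewrite -xw.
Qed.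

Lemma core_exists s : ~ contains_as_trace E (matching s.+1) ->
  exists2 B : {set V}, #|B| <= 3 * s + 3 * s * (2 * s)
    & forall e, e \in E -> 1 < #|e :&: B|.
Proof.
move=> noM; have [B0 cB0 HB0] := edge_cover noM.
have [C HC] := fin_all_exists (fun w => link_cover w noM).
exists (B0 :|: \bigcup_(w in B0) C w).
  apply: leq_trans (leq_card_setU _ _) _; apply: leq_add => //.
  apply: (@leq_trans (\sum_(w in B0) 2 * s)); last first.
    by rewrite sum_nat_const leq_mul2r cB0 orbT.
  elim/big_rec2: _ => [|w D n _ IH]; first by rewrite cards0.
  by apply: leq_trans (leq_card_setU _ _) _; rewrite leq_add //; case: (HC w).
move=> e eE; have [w we wB] := HB0 e eE.
have [_ /(_ e eE we)[v]] := HC w; rewrite in_setD1 => /andP[vw ve] vC.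
apply/card_gt1P; exists w, v; split; last by rewrite eq_sym.
  by rewrite in_setI we in_setU wB.
rewrite in_setI ve in_setU; apply/orP; right.
by apply/bigcupP; exists w.
Qed.

End TraceMatchings.

(** * Counting cliques around a core *)

Section Core.
Variables (V : finType) (E : {set {set V}}) (B : {set V}).
Hypothesis EB : forall e : {set V}, e \in E -> 1 < #|e :&: B|.
Implicit Types (T R : {set V}).

Lemma clique_almost_inside T : 2 < #|T| -> complete_on 3 T \subset E ->
  #|T :\: B| <= 1.
Proof.
move=> T3 /subsetP TE; rewrite leqNgt; apply/negP.
case/card_gt1P => u [v [uT vT uv]].
move: uT vT; rewrite !in_setD => /andP[uB uT] /andP[vB vT].
have /card_gt0P[w] : 0 < #|T :\ u :\ v|.
  by move: T3; rewrite (cardsD1 u) uT (cardsD1 v (T :\ u)) in_setD1 eq_sym uv vT; lia.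
rewrite !in_setD1 => /and3P[wv wu wT].
have /EB : [set u; v; w] \in E.
  apply: TE; rewrite inE !subUset !sub1set uT vT wT /=.
  by rewrite setUC cardsU1 cards2 in_set2 negb_or wu wv uv.
apply/negP; rewrite -leqNgt -(cards1 w); apply/subset_leq_card/subsetP => z.
rewrite in_setI !inE => /andP[+ zB].
by case/orP => [/orP[]|//] /eqP zE; move: zB; rewrite zE ?(negbTE uB) ?(negbTE vB).
Qed.

(** The cliques responsible for the linear term: a popular clique of B with one
    more vertex outside B. *)
Definition popular_extension K t T : bool :=
  (T :&: B \in cliques (popular E K) t.-1) && (T :\: B != set0).

Lemma clique_split T : 2 < #|T| -> complete_on 3 T \subset E ->
  T :\: B != set0 -> exists2 v, v \notin B & T = v |: (T :&: B).
Proof.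
move=> T3 TE; rewrite -card_gt0 => TB.
have /cards1P[v Tv] : #|T :\: B| == 1 by rewrite eqn_leq clique_almost_inside.
have : v \in T :\: B by rewrite Tv set11.
by case/setDP => _ vB; exists v => //; rewrite -Tv setUC setID.
Qed.

Lemma card_popular_extensions K t : 2 < t ->
  #|[set T : {set V} | [&& #|T| == t, complete_on 3 T \subset E
                         & popular_extension K t T]]|
    <= #|V| * #|cliques (popular E K) t.-1|.
Proof.
move=> t3; rewrite -cardsT -cardsX; set X := setX _ _.
apply: leq_trans (leq_imset_card (fun p : V * {set V} => p.1 |: p.2) X).
apply/subset_leq_card/subsetP => T; rewrite inE => /and4P[/eqP cT TE RG TB].
have [|v _ Tv] := clique_split _ TE TB; first by rewrite cT.
by apply/imsetP; exists (v, T :&: B); rewrite //= in_setX inE.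
Qed.

(** A clique T with T :&: B = R is R itself or R with a vertex w.  In the second
    case R is not a popular clique, and w completes a fixed unpopular pair u, v
    of R to a hyperedge. *)
Lemma card_unpopular_fibre K t R : 2 < t ->
  #|[set T : {set V} | [&& #|T| == t, complete_on 3 T \subset E,
                         ~~ popular_extension K t T & T :&: B == R]]| <= K.+1.
Proof.
move=> t3; set X := [set T | _].
have XP T : T \in X -> T = R \/ exists v, [/\ v \notin B, T = v |: R,
    complete_on 3 T \subset E & ~~ is_clique (popular E K) R].
  rewrite inE => /and4P[/eqP cT TE nP /eqP TR].
  have [TB|TB] := eqVneq (T :\: B) set0.
    by left; rewrite -TR; apply/esym/setIidPl; rewrite -setD_eq0 TB.
  have [|v vB Tv] := clique_split _ TE TB; first by rewrite cT.
  right; exists v; rewrite -TR; split=> //.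
  apply: contra nP => qR; rewrite /popular_extension TB inE qR !andbT.
  have : #|v |: (T :&: B)| = t by rewrite -Tv.
  by rewrite cardsU1 in_setI (negbTE vB) andbF add1n => <-.
have [qR|] := boolP (is_clique (popular E K) R).
  apply: (@leq_trans #|[set R]|); last by rewrite cards1.
  apply/subset_leq_card/subsetP => T /XP[->|[v [_ _ _]]]; first exact: set11.
  by rewrite qR.
rewrite negb_forall => /existsP[u]; rewrite negb_imply => /andP[uR].
rewrite negb_forall => /existsP[v]; rewrite negb_imply => /andP[vR].
rewrite negb_imply /popular /= negb_and => /andP[uv]; rewrite uv /= -leqNgt => cd.
have sub : X \subset R |: [set w |: R | w in [set w | [set u; v; w] \in E]].
  apply/subsetP => T TX; have RB : R \subset B.
    by move: TX; rewrite inE => /and4P[_ _ _ /eqP<-]; apply: subsetIr.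
  rewrite in_setU1; have [->|[w [wB Tw TE _]]] := XP T TX; first by rewrite eqxx.
  apply/orP; right; apply/imsetP; exists w => //; rewrite inE.
  apply: (subsetP TE); rewrite inE !subUset !sub1set Tw !in_setU1 uR vR eqxx !orbT /=.
  rewrite setUC cardsU1 cards2 in_set2 negb_or uv.
  have /negbTE-> : w != u by apply: contraNneq wB => ->; apply: (subsetP RB).
  by have /negbTE-> : w != v by apply: contraNneq wB => ->; apply: (subsetP RB).
apply: leq_trans (subset_leq_card sub) _; rewrite cardsU1 -add1n.
by apply: leq_add; [case: (_ \notin _) | apply: leq_trans (leq_imset_card _ _) cd].
Qed.

(** The cliques other than popular extensions are counted by their
    intersection with B. *)
Lemma num_cliques_core_bound K t : 2 < t ->
  num_cliques 3 t E
    <= #|V| * #|cliques (popular E K) t.-1| + 2 ^ #|B| * K.+1.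
Proof.
move=> t3; rewrite /num_cliques; set X := [set T | _].
rewrite -(cardsID [set T | popular_extension K t T] X); apply: leq_add.
  apply: leq_trans (card_popular_extensions K t3); apply/subset_leq_card/subsetP.
  by move=> T; rewrite in_setI !inE -andbA.
rewrite -card_powerset -sum_nat_const -sum1_card.
rewrite (partition_big (fun T => T :&: B) (mem (powerset B))) /=; last first.
  by move=> T _; rewrite inE subsetIr.
apply: leq_sum => R _; rewrite sum1dep_card.
apply: leq_trans (card_unpopular_fibre K R t3); apply/subset_leq_card/subsetP => T.
by rewrite /X !inE => /andP[/andP[-> /andP[-> ->]] ->].
Qed.

End Core.

(** * The construction *)

Section Construction.
Variables (V : finType) (A : {set V}).
Implicit Types (e T R : {set V}).

Lemma in_construction e :
  (e \in construction A) = (#|e| == 3) && (1 < #|e :&: A|).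
Proof.
rewrite in_setU; apply/orP/andP => [[/imset2P[v f]|]|[/eqP e3 eA]].
- rewrite !inE => vA /andP[fA /eqP f2] ->.
  have vf : v \notin f by apply: contra vA => /(subsetP fA).
  rewrite cardsU1 vf f2; split=> //; rewrite -f2; apply/subset_leq_card.
  by rewrite subsetI subsetUr.
- by rewrite inE => /andP[eA /eqP e3]; rewrite (setIidPl eA) e3.
have [eAs|eAs] := boolP (e \subset A); first by right; rewrite inE eAs e3.
left; have /cards1P[v ev] : #|e :\: A| == 1.
  have := cardsID A e; have : 0 < #|e :\: A| by rewrite card_gt0 setD_eq0.
  by rewrite e3; lia.
have : v \in e :\: A by rewrite ev set11.
case/setDP => _ vA; apply/imset2P; exists v (e :&: A); rewrite ?inE //.
  rewrite subsetIr /=; have := cardsID A e; rewrite ev cards1 e3; lia.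
by rewrite -ev setUC setID.
Qed.

Lemma construction_uniform : uniform 3 (construction A).
Proof. by move=> e; rewrite in_construction => /andP[/eqP]. Qed.

(** Every hyperedge has two vertices in A, hence each of the k matching edges
    contains a vertex of A; as #|A| = k it contains exactly one, and A lies in
    the set S on which the trace is taken.  But then a hyperedge meets A inside
    its matching edge, in at least two vertices. *)
Lemma construction_no_trace k : 0 < k -> #|A| = k ->
  ~ contains_as_trace (construction A) (matching k).
Proof.
move=> k_gt0 cA [S [cS [phi [phi_inj phiS phiE]]]].
have edge (i : 'I_k) : exists2 e, 1 < #|e :&: A| &
    #|e| = 3 /\ [set phi (i, false); phi (i, true)] = e :&: S.
  have /imsetP[e] : phi @: [set (i, false); (i, true)] \in trace (construction A) S.
    by apply: phiE; apply/imsetP; exists i.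
  rewrite in_construction => /andP[/eqP e3 eA]; rewrite imsetU1 imset_set1 => eS.
  by exists e; last split.
have cP (i : 'I_k) : #|[set phi (i, false); phi (i, true)]| = 2.
  by rewrite cards2 (inj_eq phi_inj) xpair_eqE andbF.
(* The end of the i-th matching edge that is certain to lie in A. *)
pose h (i : 'I_k) := phi (i, false) \notin A.
have hA i : phi (i, h i) \in A.
  rewrite /h; have [//|nf /=] := boolP (phi (i, false) \in A).
  have [e eA [e3 eS]] := edge i; apply: contraLR eA => /= nt.
  rewrite -leqNgt -(leq_add2r #|e :\: A|) cardsID e3 add1n !ltnS -(cP i).
  apply/subset_leq_card/subsetP => v vP; have : v \in e :&: S by rewrite -eS.
  rewrite in_setD in_setI => /andP[-> _]; rewrite andbT.
  by move: vP; rewrite in_set2 => /orP[] /eqP->.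
have hinj : injective (fun i => phi (i, h i)) by move=> i j /phi_inj[].
have imA : [set phi (i, h i) | i : 'I_k] = A.
  apply/eqP; rewrite eqEcard (card_imset _ hinj) card_ord cA leqnn andbT.
  by apply/subsetP => _ /imsetP[i _ ->].
have AS : A \subset S by rewrite -imA; apply/subsetP => _ /imsetP[i _ ->].
pose i := Ordinal k_gt0; have [e eA [e3 eS]] := edge i.
have sub : e :&: A \subset [set phi (i, false); phi (i, true)].
  by rewrite eS setIS.
have eqP : e :&: A = [set phi (i, false); phi (i, true)].
  by apply/eqP; rewrite eqEcard sub cP.
have : phi (i, ~~ h i) \in A.
  have : phi (i, ~~ h i) \in e :&: A.
    by rewrite eqP in_set2; case: (h i); rewrite eqxx ?orbT.
  by rewrite in_setI => /andP[].
rewrite -imA => /imsetP[j _ /phi_inj[ij]]; rewrite -ij.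
by case: (h i).
Qed.

Lemma construction_cliqueE T : 2 < #|T| ->
  (complete_on 3 T \subset construction A) = (#|T :\: A| <= 1).
Proof.
move=> T3; apply/idP/idP => [|TA].
  apply: clique_almost_inside T3 => e.
  by rewrite in_construction => /andP[].
apply/subsetP => e; rewrite inE in_construction => /andP[eT /eqP e3].
rewrite e3 /=; have := cardsID A e; have := subset_leq_card (setSD A eT); lia.
Qed.

Lemma num_cliques_construction t : 2 < t ->
  num_cliques 3 t (construction A) =
    'C(#|A|, t.-1) * (#|V| - #|A|) + 'C(#|A|, t).
Proof.
move=> t3; rewrite /num_cliques; set X := [set T | _].
have XE T : (T \in X) = (#|T| == t) && (#|T :\: A| <= 1).
  rewrite inE; case: eqP => //= cT; rewrite construction_cliqueE // cT //.
rewrite -(cardsID [set T : {set V} | T \subset A] X) addnC; congr (_ + _); last first.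
  rewrite -cards_draws; apply: eq_card => T; rewrite in_setI XE !inE.
  have [TA|//] := boolP (T \subset A); last by rewrite andbF.
  by move: (TA); rewrite -setD_eq0 => /eqP->; rewrite cards0 !andbT.
have -> : #|V| - #|A| = #|~: A| by rewrite -(cardsC A) addKn.
rewrite -cards_draws mulnC -cardsX.
rewrite -(card_in_imset (f := fun p : V * {set V} => p.1 |: p.2)) /=; last first.
  move=> [v R] [w Q]; rewrite !in_setX !inE /= => /and3P[vA RA _] /and3P[wA QA _] eq.
  have out z : z \notin A -> [set z] :&: A = set0.
    by move=> zA; apply/eqP; rewrite setI_eq0 disjoints1.
  have RE : R = Q.
    have := congr1 (fun Z => Z :&: A) eq; rewrite /= !setIUl.
    rewrite (setIidPl RA) (setIidPl QA).
    by rewrite !out // !set0U.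
  congr (_, _) => //; have : v \in w |: Q by rewrite -eq setU11.
  rewrite in_setU1 => /predU1P[//|/(subsetP QA)].
  by rewrite (negbTE vA).
apply: eq_card => T; rewrite in_setD XE inE; apply/idP/imsetP.
  case/and3P => TA /eqP cT TD.
  have /cards1P[v Tv] : #|T :\: A| == 1 by rewrite eqn_leq TD card_gt0 setD_eq0.
  have : v \in T :\: A by rewrite Tv set11.
  case/setDP => _ vA; exists (v, T :&: A) => /=; last by rewrite -Tv setUC setID.
  rewrite in_setX !inE vA subsetIr /=; have := cardsID A T; rewrite Tv cards1 cT; lia.
case=> [[v R]]; rewrite in_setX !inE /= => /and3P[vA RA /eqP cR] ->.
have vR : v \notin R by apply: contra vA => /(subsetP RA).
rewrite subUset sub1set (negbTE vA) cardsU1 vR cR setDUl.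
have -> : R :\: A = set0 by apply/eqP; rewrite setD_eq0.
rewrite setU0; apply/and3P; split=> //; first by lia.
by apply: leq_trans (subset_leq_card (subsetDl _ _)) _; rewrite cards1.
Qed.

End Construction.

Lemma num_cliques_subset (V : finType) r t (E F : {set {set V}}) :
  E \subset F -> num_cliques r t E <= num_cliques r t F.
Proof.
move=> EF; apply/subset_leq_card/subsetP => T; rewrite !inE => /andP[->] /= TE.
exact: subset_trans TE EF.
Qed.

(** * The extremal bound *)

Lemma num_cliques_trace_free s t : 3 < t -> t <= s ->
  exists n0, forall (V : finType) (E : {set {set V}}), n0 <= #|V| ->
    uniform 3 E -> ~ contains_as_trace E (matching s.+1) ->
    num_cliques 3 t E <= 'C(s.+1, t.-1) * (#|V| - s.+1) + 'C(s.+1, t).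
Proof.
move=> t4 ts; pose K := 3 * s.+1; pose b := 3 * s + 3 * s * (2 * s).
(* The constant term of the core bound plus the loss from n to n - (s+1). *)
exists (2 ^ b * K.+1 + 'C(s.+1, t.-1) * s.+1) => V E nV E3 noM.
have He := popular_escape_bounded E3 noM.
have ps := popular_sym E K; have pi := popular_irr E K.
have [big|few] := leqP 'C(s.+1, t.-1) #|cliques (popular E K) t.-1|.
  have [|A [cA qA]] := clique_bound_tight ps pi He _ big; first by lia.
  rewrite -cA -num_cliques_construction; last by lia.
  apply: num_cliques_subset; apply/subsetP => e eE.
  rewrite in_construction (E3 e eE) /=.
  exact: edges_meet_popular_clique noM cA qA eE.
have [B cB EB] := core_exists E3 noM.
have le : 2 ^ #|B| * K.+1 <= 2 ^ b * K.+1 by rewrite leq_mul2r leq_exp2l ?cB ?orbT.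
apply: leq_trans (num_cliques_core_bound EB K (ltnW t4)) _.
move: few le nV; move: (2 ^ b * _) (2 ^ _ * _) 'C(_, t.-1) => x y C.
move: #|cliques _ _| #|V| 'C(_, _) => q n D; nia.
Qed.

Theorem theorem1p5 (s t : nat) (ht : 4 <= t) (hts : t <= s) :
  (exists n0 : nat, forall n : nat, n0 <= n ->
     forall (V : finType) (E : {set {set V}}),
       #|V| = n -> uniform 3 E -> ~ contains_as_trace E (matching (s + 1)) ->
       num_cliques 3 t E <= 'C(s + 1, t - 1) * (n - s - 1) + 'C(s + 1, t))
  /\ (forall (V : finType) (A : {set V}), #|A| = s + 1 ->
        uniform 3 (construction A)
        /\ ~ contains_as_trace (construction A) (matching (s + 1)))
  /\ (exists C : nat, forall (n : nat) (V : finType) (A : {set V}),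
        #|V| = n -> #|A| = s + 1 ->
        (`| (num_cliques 3 t (construction A))%:Z
            - ('C(s + 1, t - 1) * n)%:Z | <= C%:Z)%R)
  /\ (forall eps : rat, (0 < eps)%R ->
        exists n1 : nat, forall n : nat, n1 <= n ->
        forall (V : finType) (A : {set V}), #|V| = n -> #|A| = s + 1 ->
        (`| (num_cliques 3 t (construction A))%:R
            - ('C(s + 1, t - 1) * (n - s - 1) + 'C(s + 1, t))%:R |
         <= eps * ('C(s + 1, t - 1) * (n - s - 1) + 'C(s + 1, t))%:R)%R).
Proof.
have count (V : finType) (A : {set V}) : #|A| = s + 1 ->
    num_cliques 3 t (construction A)
      = 'C(s + 1, t - 1) * (#|V| - s - 1) + 'C(s + 1, t).
  by move=> cA; rewrite num_cliques_construction ?(ltnW ht) // cA subn1 subnDA.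
split; [|split; [|split]].
- have [n0 H] := num_cliques_trace_free ht hts.
  exists n0 => n n0n V E cV E3; rewrite addn1 subn1 -subnDA addn1 -cV.
  by apply: H => //; rewrite cV.
- move=> V A cA; split; first exact: construction_uniform.
  by apply: construction_no_trace; rewrite // addn1.
(* The difference is exactly 'C(s+1, t) - 'C(s+1, t-1)(s+1). *)
- exists ('C(s + 1, t) + 'C(s + 1, t - 1) * (s + 1)) => n V A cV cA.
  have An : s + 1 <= n by rewrite -cV -cA max_card.
  rewrite (count _ _ cA) cV; move: 'C(_, _) 'C(_, _) => C1 C2; nia.
- move=> eps eps_gt0; exists 0 => n _ V A cV cA.
  by rewrite (count _ _ cA) cV subrr normr0 mulr_ge0 ?ler0n // ltW.
Qed.
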